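(* Let $W$ be a snake name and $x$ a letter of $W$ that appears $p>2$ times in $W$, so that $W=X_0\,x\,X_1\,x\cdots x\,X_{p-1}\,x\,X_p$ where the (possibly empty) subwords $X_0,\ldots,X_p$ do not contain $x$. Let $x_1,\ldots,x_{p-1}$ be $p-1$ distinct new letters not occurring in $W$. Then the binary reduction of $W$ with respect to $x$, $$W_x=X_0\,x_1\,X_1\,x_1x_2\,X_2\,x_2x_3\cdots x_{p-2}x_{p-1}\,X_{p-1}\,x_{p-1}\,X_p,$$ is a snake name.
   Context: A word is a finite sequence $W=[w_1\cdots w_m]$ of letters; a subword $[w_j\cdots w_k]$ consists of consecutive entries, and $[w_j\cdots w_k)$ consists of the entries in positions $j,\ldots,k-1$. A word is primitive if it has no repeated letters. A word $[w_1\cdots w_m]$ is semi-primitive if $w_1=w_m$ and $[w_1\cdots w_m)$ is primitive. A non-empty word $W=[w_1\cdots w_m]$ is a snake name if (i) each letter of $W$ appears in $W$ at least twice; (ii) for any $k\in\{2,\ldots,m-1\}$ there is a semi-primitive subword $[w_j\cdots w_l]$ of $W$ with $j<k<l$. In $W_x$ the first and last entries $x$ of $W$ are replaced by the single letters $x_1$ and $x_{p-1}$ respectively, while the $i$-th entry $x$, $1<i<p$, is replaced by the two consecutive letters $x_{i-1}x_i$. *)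

(* Defs.v *)
From mathcomp Require Import all_boot.

Set Implicit Arguments.
Unset Strict Implicit.
Unset Printing Implicit Defensive.

Section Words.

Variable T : eqType.
Implicit Types (V W : seq T) (x : T) (X : nat -> seq T) (y : nat -> T).

(* [w_j ... w_l], with positions numbered from 1; meaningful for
   1 <= j <= l <= size W. *)
Definition subword W j l : seq T := take (l - j).+1 (drop j.-1 W).

Definition primitive W : bool := uniq W.

(* [belast v V'] is the word v :: V' without its last entry. *)
Definition semi_primitive W : bool :=
  if W is v :: V' then (v == last v V') && primitive (belast v V') else false.

Definition snake_name W : Prop :=
  [/\ W <> [::],
      forall a, a \in W -> 2 <= count_mem a W
    & forall k, 2 <= k <= (size W).-1 ->
        exists j l, [/\ 1 <= j, j < k < l, l <= size W
                      & semi_primitive (subword W j l)]].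

(* W = X_0 x X_1 x ... x X_p, where no X_i contains x; only X 0, ..., X p
   matter. *)
Definition decomposition x p X W : Prop :=
  (forall i, i <= p -> x \notin X i) /\
  W = X 0 ++ \big[cat/[::]]_(1 <= i < p.+1) (x :: X i).

(* X_0 y_1 X_1 (y_1 y_2 X_2) ... (y_(p-2) y_(p-1) X_(p-1)) y_(p-1) X_p,
   for p >= 2; only y 1, ..., y (p - 1) matter. *)
Definition binary_reduction p X y : seq T :=
  X 0 ++ y 1 :: X 1
    ++ \big[cat/[::]]_(2 <= i < p) (y (i - 1) :: y i :: X i)
    ++ y (p - 1) :: X p.

End Words.

(* Main.v *)
Require Import Defs.
From mathcomp Require Import all_boot.
From mathcomp Require Import zify.

Set Implicit Arguments.
Unset Strict Implicit.
Unset Printing Implicit Defensive.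

(** [W_x] arises from [W] by replacing the [i]-th [x] by a block of one or two
    new letters.  Take an inner entry of [W_x] and the entry [c] of [W] whose
    block contains it.  Then [c] is an inner entry of [W], since the first
    and the last [x] are replaced by a single letter.  Hence [c] lies
    strictly inside a semi-primitive [a M a].  If [a <> x], then [M] contains
    [x] at most once, so expanding it keeps its letters distinct.  If [a = x],
    then [M] avoids [x], and the two consecutive blocks of [x] at its ends share
    the letter [x_i], so that [x_i M x_i] is semi-primitive in [W_x]. *)

(** * Condition (ii) of snake names without positions *)

Section Covering.

Variable T : eqType.
Implicit Types (P Q U V S W : seq T) (a c : T).

Lemma cat_eq_cat_cons U V P c Q : U ++ V = P ++ c :: Q ->
  (exists2 Q', U = P ++ c :: Q' & Q = Q' ++ V) \/
  (exists2 P', P = U ++ P' & V = P' ++ c :: Q).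
Proof.
elim: U P => [|u U IHU] [|a P] //=.
- by move=> ->; right; exists [::].
- by move=> ->; right; exists (a :: P).
- by case=> -> <-; left; exists U.
case=> -> /IHU[[Q' -> ->]|[P' -> ->]]; first by left; exists Q'.
by right; exists P'.
Qed.

(** The semi-primitive word around [c] is [a U2 c V1 a]. Cutting it out explicitly lets it be
    carried through a substitution without computing positions. *)
Definition covered P c Q := exists a U1 U2 V1 V2,
  [/\ P = U1 ++ a :: U2, Q = V1 ++ a :: V2 & uniq (a :: U2 ++ c :: V1)].

Lemma semi_primitive_rcons a b S :
  semi_primitive (a :: rcons S b) = (a == b) && uniq (a :: S).
Proof. by rewrite /= last_rcons belast_rcons. Qed.

Lemma snake_coveredP W :
  (forall k, 2 <= k <= (size W).-1 -> exists j l,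
     [/\ 1 <= j, j < k < l, l <= size W & semi_primitive (subword W j l)]) <->
  (forall P c Q, W = P ++ c :: Q -> P <> [::] -> Q <> [::] -> covered P c Q).
Proof.
split=> [covW P c Q defW P0 Q0|covW k].
  have sP : 0 < size P by case: (P) P0.
  have sQ : 0 < size Q by case: (Q) Q0.
  have sW : size W = size P + (size Q).+1 by rewrite defW size_cat.
  have [|j [l [j1 /andP[jk kl] lW]]] := covW (size P).+1; first by lia.
  have sS : size (subword W j l) = (l - j).+1.
    by rewrite size_take size_drop; case: ifP; lia.
  case defS: (subword W j l) sS => [|a S] //=.
  case/lastP: S defS => [|M e] defS; first by move=> /=; lia.
  rewrite -/(semi_primitive (a :: rcons M e)) semi_primitive_rcons size_rcons.
  case=> sM /andP[/eqP eq_ae uM]; move: defS; rewrite -{}eq_ae => defS.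
  have := cat_take_drop j.-1 W.
  rewrite -[drop j.-1 W](cat_take_drop (l - j).+1).
  rewrite -[take _ (drop _ _)]/(subword W j l).
  rewrite defS; set V2 := drop _ (drop _ _).
  have sU1 : size (take j.-1 W) = j.-1 by rewrite size_take; case: ifP; lia.
  set U1 := take _ _ in sU1 *.
  (* Two factorisations of [W] are compared: [j < k] puts [c] after the opening [a], and [k < l]
     puts it before the closing one, so [c] falls in [M]. *)
  rewrite {1}defW /= cat_rcons.
  case/cat_eq_cat_cons=> [[Q' defU1 _]|[[|a' U2] defP]].
  - by move: sU1; rewrite defU1 size_cat /=; lia.
  - by move: jk; rewrite defP cats0 sU1; lia.
  case=> eq_a; rewrite -{a'}eq_a in defP *.
  case/cat_eq_cat_cons=> [[V1 defM defQ]|[P' defU2 _]].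
    by exists a, U1, U2, V1, V2; split; rewrite // -defM.
  by move: kl; rewrite defP defU2 !size_cat /= size_cat sU1; lia.
case/andP=> k2 kW.
have defW : W = take k.-1 W ++ drop k.-1 W by rewrite cat_take_drop.
have sD : size (drop k.-1 W) = size W - k.-1 by rewrite size_drop.
have sK : size (take k.-1 W) = k.-1 by rewrite size_take; case: ifP; lia.
case defD: (drop k.-1 W) => [|c Q]; first by move: sD; rewrite defD /=; lia.
rewrite defD in defW sD; move: sD sK => /= sQ sP.
have [||a [U1 [U2 [V1 [V2 [defP defQ ucov]]]]]] := covW _ _ _ defW.
- by move=> P0; move: sP; rewrite P0 /=; lia.
- by move=> Q0; move: sQ; rewrite Q0 /=; lia.
have sW : size W = size U1 + size U2 + size V1 + size V2 + 3.
  by rewrite defW defP defQ !size_cat /= !size_cat /=; lia.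
rewrite defP size_cat /= in sP.
set M := U2 ++ c :: V1 in ucov.
(* The positions, counted from 1, of the two copies of [a] around [M]. *)
exists (size U1).+1, (size U1 + size M).+2.
split=> //; rewrite /M ?size_cat /=; try lia.
have -> : subword W (size U1).+1 (size U1 + (size U2 + (size V1).+1)).+2
          = a :: rcons M a.
  rewrite defW defP defQ /subword -catA drop_size_cat //= -cats1.
  rewrite (_ : _ - _ = size (M ++ [:: a])); last first.
    by rewrite /M !size_cat /=; lia.
  by rewrite /M -cat_cons -(cat1s a V2) !catA take_size_cat // -catA.
by rewrite semi_primitive_rcons eqxx.
Qed.

End Covering.

(** * Substitution of blocks for the successive occurrences of a letter *)

Section Expansion.

Variables (T : eqType) (x : T) (b : nat -> seq T).
Implicit Types (P Q U V S W : seq T) (a c : T) (X : nat -> seq T).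

Definition expand_letter i c := if c == x then b i else [:: c].

(* The counter [i] is the rank of the next occurrence of [x]. *)
Fixpoint expand i S : seq T :=
  if S is c :: S' then expand_letter i c ++ expand (i + (c == x)) S'
  else [::].

Lemma expand_cat i U V :
  expand i (U ++ V) = expand i U ++ expand (i + count_mem x U) V.
Proof.
elim: U i => [|u U IHU] i /=; first by rewrite addn0.
by rewrite IHU catA addnA.
Qed.

Lemma expand_id i S : x \notin S -> expand i S = S.
Proof.
elim: S i => //= c S IHS i; rewrite inE negb_or eq_sym /expand_letter.
by case/andP=> /negbTE-> /IHS->.
Qed.

(** Traces an entry [c] of the expansion back to the letter [d] whose image contains it; [P'] and
    [Q'] are the rest of that image. *)
Lemma expand_split i S P c Q : expand i S = P ++ c :: Q ->
  exists U d V P' Q',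
    [/\ S = U ++ d :: V, expand_letter (i + count_mem x U) d = P' ++ c :: Q',
        P = expand i U ++ P'
      & Q = Q' ++ expand (i + count_mem x U + (d == x)) V].
Proof.
elim: S i P => [|d S IHS] i P /=; first by case: P.
case/cat_eq_cat_cons=> [[Q' def_d defQ]|[P1 -> /IHS]].
  by exists [::], d, S, P, Q'; rewrite addn0.
case=> U [e [V [P' [Q' [-> def_e -> ->]]]]].
exists (d :: U), e, V, P', Q' => /=.
by rewrite -catA addnA.
Qed.

Lemma count_expand i S a : a != x -> (forall j, a \notin b j) ->
  count_mem a (expand i S) = count_mem a S.
Proof.
move=> a_x a_b; elim: S i => //= c S IHS i; rewrite count_cat IHS.
rewrite /expand_letter; case: eqP => [->|_] /=; last by rewrite addn0.
by rewrite eq_sym (negbTE a_x) (count_memPn (a_b i)).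
Qed.

(** A primitive word contains [x] at most once, so at most one block is inserted. Hence blocks of
    different ranks may share letters. *)
Lemma expand_uniq i S : uniq S -> (forall j, uniq (b j)) ->
  (forall j a, a \in b j -> a \notin S) -> uniq (expand i S).
Proof.
move=> uS ub bS; have [xS|xS] := boolP (x \in S); last by rewrite expand_id.
case/splitPr: xS uS bS => S1 S2; rewrite uniq_catC /= mem_cat negb_or -andbA.
case/and3P=> xS2 xS1 uS bS.
rewrite expand_cat /= /expand_letter eqxx !expand_id //.
rewrite uniq_catCA cat_uniq ub uniq_catC uS andbT.
apply/hasPn => a; rewrite mem_cat => aS; apply/negP => /bS.
by rewrite mem_cat inE !negb_or; case/orP: aS => ->; rewrite ?andbF.
Qed.

Lemma leq_count_expand i S a :
  \sum_(i <= j < i + count_mem x S) count_mem a (b j)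
    <= count_mem a (expand i S).
Proof.
elim: S i => [|c S IHS] i /=; first by rewrite addn0 big_geq.
rewrite count_cat addnA /expand_letter; case: eqP => _ /=; last first.
  by rewrite !addn0 (leq_trans (IHS i)) ?leq_addl.
rewrite addn1 big_ltn ?ltn_addr // leq_add2l.
exact: IHS.
Qed.

Lemma mem_expand i S a : a \in expand i S ->
  (a \in S /\ a != x) \/ (exists j, a \in b j).
Proof.
elim: S i => //= c S IHS i; rewrite mem_cat /expand_letter inE.
case/orP=> [|/IHS[[-> ->]|]]; [|by left; rewrite orbT|by right].
case: (eqVneq c x) => [_ ab|cx]; first by right; exists i.
by rewrite inE => /eqP->; left; rewrite eqxx.
Qed.

(** Each summand contains exactly one [x], so the rank counter agrees with the summation index. *)
Lemma expand_bigcat X m n : m <= n -> (forall i, m <= i < n -> x \notin X i) ->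
  expand m (\big[cat/[::]]_(m <= i < n) (x :: X i)) =
  \big[cat/[::]]_(m <= i < n) (b i ++ X i).
Proof.
move=> lemn; rewrite -(subnKC lemn); elim: (n - m) {lemn} => [|d IHd] xX.
  by rewrite addn0 !big_geq.
rewrite addnS !big_nat_recr ?leq_addr //= expand_cat IHd; last first.
  by move=> i /andP[mi id]; rewrite xX // mi addnS ltnW.
have xd : x \notin X (m + d) by rewrite xX // leq_addr addnS /=.
have -> : count_mem x (\big[cat/[::]]_(m <= i < m + d) (x :: X i)) = d.
  rewrite (big_morph _ (count_cat _) (erefl : count_mem x [::] = 0)).
  rewrite (eq_big_nat _ _ (F2 := fun=> 1)) => [|i /andP[mi id]].
    by rewrite sum_nat_const_nat muln1 addKn.
  by rewrite /= eqxx (count_memPn _) ?xX // mi addnS ltnW.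
by rewrite /= /expand_letter eqxx expand_id.
Qed.

End Expansion.

(** * The binary reduction as an expansion *)

Section Reduction.

Variables (T : eqType) (x : T) (p : nat) (y : nat -> T).
Implicit Types (U V W : seq T) (X : nat -> seq T).

(* For [i] outside [1, p] the block is empty, so that every block consists of
   distinct new letters. *)
Definition block i :=
  if i == 1 then [:: y 1] else if i == p then [:: y (p - 1)]
  else if 1 < i < p then [:: y (i - 1); y i] else [::].

Lemma block_mem i a : 2 < p -> a \in block i -> exists2 j, 1 <= j < p & a = y j.
Proof.
move=> p2; rewrite /block; case: eqP => _.
  by rewrite inE => /eqP->; exists 1 => //; lia.
case: eqP => _; first by rewrite inE => /eqP->; exists (p - 1) => //; lia.
case: ifP => // ip; rewrite !inE.
by case/orP=> /eqP->; [exists (i - 1) | exists i] => //; lia.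
Qed.

(** With [block_cons], this shows that [y i] ends one block and begins the next: it takes over the
    role of [x] as the common end letter. *)
Lemma block_rcons i : 1 <= i < p -> exists B, block i = rcons B (y i).
Proof.
move=> ip; rewrite /block; case: eqP => [->|i1]; first by exists [::].
case: eqP => [?|_]; first by lia.
by rewrite (_ : 1 < i < p); [exists [:: y (i - 1)] | lia].
Qed.

Lemma block_cons i : 1 <= i < p -> exists B, block i.+1 = y i :: B.
Proof.
move=> ip; rewrite /block; case: eqP => [?|_]; first by lia.
case: eqP => [<-|i1]; first by exists [::]; rewrite subn1.
by rewrite (_ : 1 < i.+1 < p); [exists [:: y i.+1]; rewrite subn1 | lia].
Qed.

(** By induction: a leading [x] puts an empty piece before the others, and any other leading letter
    joins the piece [X 0]. *)
Lemma decomposition_exists W : exists X, decomposition x (count_mem x W) X W.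
Proof.
elim: W => [|a W [X [xX defW]]].
  by exists (fun=> [::]); split=> //; rewrite big_geq.
rewrite /=; case: eqP => [->|/eqP ax].
  exists (fun i => if i is j.+1 then X j else [::]); split; first by case.
  by rewrite add1n big_nat_recl //= {1}defW big_add1.
exists (fun i => if i is j.+1 then X j.+1 else a :: X 0); split.
  case=> [|i] ip; last exact: xX.
  by rewrite inE eq_sym negb_or ax xX.
by rewrite {1}defW /= !big_add1.
Qed.

Lemma binary_reductionE X W : 2 < p -> decomposition x p X W ->
  binary_reduction p X y = expand x block 1 W.
Proof.
move=> p2 [xX ->]; have x0 := xX 0 isT.
rewrite expand_cat (count_memPn x0) expand_id // addn0.
rewrite expand_bigcat => // [|i /andP[_]]; last exact: xX.
rewrite big_ltn; last by lia.
rewrite big_nat_recr /=; last by lia.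
rewrite /binary_reduction /block (_ : (p == 1) = false) ?eqxx; last by lia.
congr (_ ++ _ :: _ ++ _ ++ _); apply: eq_big_nat => i ip.
by rewrite ip; do 2![case: eqP => [?|_]; first by lia].
Qed.

Hypothesis p_gt2 : 2 < p.
Hypothesis y_inj : forall i j, 1 <= i < p -> 1 <= j < p -> y i = y j -> i = j.

Lemma block_uniq i : uniq (block i).
Proof.
rewrite /block; do 3![case: ifP => // ?]; rewrite /= inE !andbT.
by apply/eqP => /y_inj; lia.
Qed.

Lemma count_binary_reduction W a : count_mem x W = p ->
  (forall i, 1 <= i < p -> y i \notin W) ->
  (forall c, c \in W -> 2 <= count_mem c W) ->
  a \in expand x block 1 W -> 2 <= count_mem a (expand x block 1 W).
Proof.
move=> cx y_new cW /mem_expand[[aW ax]|[i /block_mem[//|j jp ->]]].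
  rewrite count_expand ?cW // => j; apply/negP => /block_mem[//|i ip ay].
  by move: (y_new i ip); rewrite -ay aW.
apply: leq_trans (leq_count_expand _ _ _ _ _).
(* The sum is cut at [j] to isolate the blocks of ranks [j] and [j + 1], each of which contains
   [y j]. *)
rewrite cx (big_cat_nat (n := j)) /=; [|lia..].
apply: leq_trans (leq_addl _ _).
rewrite big_ltn; last by lia.
rewrite big_ltn; last by lia.
have [B ->] := block_rcons jp; have [B' ->] := block_cons jp.
by rewrite -cats1 count_cat /= eqxx; lia.
Qed.

Lemma covered_expand_letter U d V P' c Q' :
  count_mem x (U ++ d :: V) = p ->
  (forall i, 1 <= i < p -> y i \notin U ++ d :: V) ->
  covered U d V ->
  expand_letter x block (1 + count_mem x U) d = P' ++ c :: Q' ->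
  covered (expand x block 1 U ++ P') c
    (Q' ++ expand x block (1 + count_mem x U + (d == x)) V).
Proof.
move=> cx y_new [a [U1 [U2 [V1 [V2 [defU defV uM]]]]]] def_d.
have [defa|/negbTE ax] := eqVneq a x; last first.
  exists a, (expand x block 1 U1), (expand x block (1 + count_mem x U1) U2 ++ P').
  exists (Q' ++ expand x block (1 + count_mem x U + (d == x)) V1).
  exists (expand x block (1 + count_mem x U + (d == x) + count_mem x V1) V2).
  split.
  - by rewrite defU expand_cat /= /expand_letter ax addn0 -catA.
  - by rewrite defV expand_cat /= /expand_letter ax addn0 -catA.
  (* With [P'] and [Q'] included, the word is the full expansion of the primitive word [a U2 d V1],
     so [expand_uniq] applies. *)
  have -> : a :: (expand x block (1 + count_mem x U1) U2 ++ P') ++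
      c :: Q' ++ expand x block (1 + count_mem x U + (d == x)) V1
    = expand x block (1 + count_mem x U1) (a :: U2 ++ d :: V1).
    rewrite /= ax addn0 expand_cat /= {1}/expand_letter ax /=.
    rewrite -catA -(cat_cons c) (catA P') -def_d.
    by rewrite defU count_cat /= ax add0n addnA.
  apply: expand_uniq => // [j|j e /block_mem[//|i ip ->]].
    exact: block_uniq.
  apply: contra (y_new i ip); rewrite defU defV !(mem_cat, inE).
  by case/or4P=> ->; rewrite ?orbT.
rewrite {a}defa in defU defV uM.
have [xU2 dx xV1] : [/\ x \notin U2, d != x & x \notin V1].
  move: uM => /= /andP[]; rewrite mem_cat inE !negb_or eq_sym.
  by case/and3P.
(* The rank of the opening [x]. No [x] lies between it and the closing one, which therefore has rank
   [i + 1]; this gives [i < p]. *)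
set i := (count_mem x U1).+1.
have cU : count_mem x U = i.
  by rewrite defU count_cat /= eqxx (count_memPn xU2) /i; lia.
have ip : 1 <= i < p.
  rewrite -cx count_cat cU /= defV count_cat /= eqxx /i; lia.
have [B bi] := block_rcons ip; have [B' bi1] := block_cons ip.
move: def_d; rewrite /expand_letter (negbTE dx) cU add1n addn0.
case: P' => [|? []] //= [<- <-] /=.
exists (y i), (expand x block 1 U1 ++ B), U2, V1.
exists (B' ++ expand x block i.+2 V2); split.
- rewrite cats0 defU expand_cat /= /expand_letter eqxx add1n -/i bi.
  by rewrite (expand_id _ _ xU2) -cats1 -!catA.
- rewrite defV expand_cat (expand_id _ _ xV1) (count_memPn xV1) addn0 /=.
  by rewrite /expand_letter eqxx bi1 addn1.
move: uM => /= /andP[_ ->]; rewrite andbT.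
apply: contra (y_new i ip); rewrite defU defV !(mem_cat, inE).
by case/or3P=> ->; rewrite ?orbT.
Qed.

Lemma snake_name_expand W : snake_name W -> count_mem x W = p ->
  (forall i, 1 <= i < p -> y i \notin W) -> snake_name (expand x block 1 W).
Proof.
case=> _ cW /snake_coveredP covW cx y_new; split.
- move=> W0; have := leq_count_expand x block 1 W (y 1).
  by rewrite W0 cx big_ltn ?ltnS ?(leq_trans _ p_gt2) //= eqxx.
- move=> a; exact: count_binary_reduction.
apply/snake_coveredP => P c Q /expand_split.
case=> U [d [V [P' [Q' [defW def_d -> ->]]]]] P0 Q0.
rewrite defW in cx y_new.
(* If [d] were the first or last letter of [W], its image would be a single letter, even for
   [d = x], whose rank is then 1 or [p]. So [P] or [Q] would be empty. *)
have single e : [:: e] = P' ++ c :: Q' -> P' = [::] /\ Q' = [::].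
  by case: (P') => [[_ <-]|? []].
apply: covered_expand_letter => //; apply: covW => // [U0|V0].
- case: P0; rewrite U0 /= in def_d *.
  by move: def_d; rewrite /expand_letter; case: eqP => _ /single[].
- case: Q0; rewrite V0 cats0; move: cx def_d.
  rewrite V0 count_cat /= addn0 /expand_letter.
  case: eqP => _ cx; last by case/single.
  rewrite addnC cx /block eqxx; case: eqP => [?|_]; first by lia.
  by case/single.
Qed.

End Reduction.

(** The first conjunct ensures that the second, stated for every decomposition, is not vacuous. *)
Theorem proposition6p32 (T : eqType) (W : seq T) (x : T) (p : nat) (y : nat -> T)
  (snakeW : snake_name W)
  (count_x : count_mem x W = p) (p_gt2 : 2 < p)
  (y_distinct : forall i j, 1 <= i < p -> 1 <= j < p -> y i = y j -> i = j)
  (y_new : forall i, 1 <= i < p -> y i \notin W) :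
  (exists X : nat -> seq T, decomposition x p X W) /\
  (forall X : nat -> seq T, decomposition x p X W ->
     snake_name (binary_reduction p X y)).
Proof.
split=> [|X decW]; first by rewrite -count_x; apply: decomposition_exists.
by rewrite (binary_reductionE y p_gt2 decW); apply: snake_name_expand.
Qed.
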